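(* Let $X$ and $Y$ be independent and identically distributed random variables with distribution function $F$ on $\mathbb{R}$, let $\psi:\mathbb{R}\to\mathbb{R}$ be a measurable function, and let $\chi:\mathbb{R}\to\mathbb{R}$ be a nonnegative weight function. Then the inequalities $$\begin{aligned}&E_F\Big(\Big|E_F\big(\psi(Y)\{\mathbf 1_{[Y<X]}+\tfrac12\mathbf 1_{[Y=X]}\}\mid X\big)\psi(X)\Big|\,\chi(X)\Big)\\&\quad\le E_F\Big(|\psi(X)\psi(Y)|\,\chi(X)\{\mathbf 1_{[Y<X]}+\tfrac12\mathbf 1_{[Y=X]}\}\Big)\\&\quad\le\tfrac12E_F\Big(\psi^2(X)\big[\chi(X)\{\mathbf 1_{[Y<X]}+\tfrac12\mathbf 1_{[Y=X]}\}+\chi(Y)\{\mathbf 1_{[Y>X]}+\tfrac12\mathbf 1_{[Y=X]}\}\big]\Big)\end{aligned}\qquad(1)$$ and $$\begin{aligned}&E_F\Big(\Big|E_F\big(\psi(Y)\{\mathbf 1_{[Y>X]}+\tfrac12\mathbf 1_{[Y=X]}\}\mid X\big)\psi(X)\Big|\,\chi(X)\Big)\\&\quad\le E_F\Big(|\psi(X)\psi(Y)|\,\chi(X)\{\mathbf 1_{[Y>X]}+\tfrac12\mathbf 1_{[Y=X]}\}\Big)\\&\quad\le\tfrac12E_F\Big(\psi^2(X)\big[\chi(X)\{\mathbf 1_{[Y>X]}+\tfrac12\mathbf 1_{[Y=X]}\}+\chi(Y)\{\mathbf 1_{[Y<X]}+\tfrac12\mathbf 1_{[Y=X]}\}\big]\Big)\end{aligned}\qquad(2)$$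 hold, with equality (throughout both chains) if $\psi$ is constant $F$-almost everywhere. If $\chi$ is nonincreasing, then the last expression in (1) is bounded from above by $\tfrac12E_F(\psi^2(X)\chi(X))$; if $\chi$ is nondecreasing, then the last expression in (2) is bounded from above by $\tfrac12E_F(\psi^2(X)\chi(X))$.
   Context: The distribution function is $F(x)=P_F(X\le x)$, $x\in\mathbb{R}$ (it may have atoms); $E_F$ denotes expectation when the random variables have distribution function $F$. $\mathbf 1_{[\cdot]}$ denotes an indicator. The conditional expectation given $X=x$ is $$E_F\big(\psi(Y)\{\mathbf 1_{[Y<X]}+\tfrac12\mathbf 1_{[Y=X]}\}\mid X=x\big)=\int_{-\infty}^{\infty}\psi(y)\{\mathbf 1_{[y<x]}+\tfrac12\mathbf 1_{[y=x]}\}\,dF(y),$$ and likewise with $<$ replaced by $>$. ''$F$-almost everywhere'' means almost everywhere with respect to the probability measure on $\mathbb{R}$ induced by $F$. *)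

(* Defs.v *)
From HB Require Import structures.
From mathcomp Require Import all_boot all_order all_algebra.
From mathcomp Require Import all_classical all_reals all_analysis.

Set Implicit Arguments.
Unset Strict Implicit.
Unset Printing Implicit Defensive.

Import Order.TTheory GRing.Theory Num.Theory.
Import numFieldNormedType.Exports.

Local Open Scope classical_set_scope.
Local Open Scope ring_scope.
Local Open Scope ereal_scope.

Definition independent_RVs {d} {T : measurableType d} {R : realType}
    (P : probability T R) (X Y : {RV P >-> R}) : Prop :=
  forall A B : set R, measurable A -> measurable B ->
    P (X @^-1` A `&` Y @^-1` B) = P (X @^-1` A) * P (Y @^-1` B).

Definition has_df {d} {T : measurableType d} {R : realType}
    (P : probability T R) (X : {RV P >-> R}) (F : R -> R) : Prop :=
  forall r : R, cdf X r = (F r)%:E.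

(* [halflt x y] and [halfgt x y] are 1_[y < x] + 1_[y = x] / 2 and
   1_[y > x] + 1_[y = x] / 2: the first argument stands for X, the second
   for Y. *)
Definition halflt {R : realType} (x y : R) : R :=
  ((y < x)%R%:R + 2^-1 * (y == x)%:R)%R.

Definition halfgt {R : realType} (x y : R) : R :=
  ((y > x)%R%:R + 2^-1 * (y == x)%:R)%R.

(* E_F(g(X, Y) | X = x) for independent X and Y with distribution function F;
   it is extended-real valued since [g x] need not be integrable. *)
Definition cond_expectation {R : realType} (F : cumulativeBounded (0 : R) (1 : R))
    (g : R -> R -> R) (x : R) : \bar R :=
  \int[lebesgue_stieltjes_measure F]_y (g x y)%:E.

Section expressions.
Context {d} {T : measurableType d} {R : realType} (P : probability T R).
Variables (F : cumulativeBounded (0 : R) (1 : R)) (X Y : {RV P >-> R}).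
Variables (psi chi : R -> R).

(* The integrand is extended-real valued, hence [\int[P]] and not ['E_P]. *)
Definition first_expr (k : R -> R -> R) : \bar R :=
  \int[P]_w
    (`| cond_expectation F (fun x y => psi y * k x y)%R (X w) * (psi (X w))%:E |
     * (chi (X w))%:E).

Definition middle_expr (k : R -> R -> R) : \bar R :=
  'E_P[fun w => (`|psi (X w) * psi (Y w)| * chi (X w) * k (X w) (Y w))%R].

Definition last_expr (k k' : R -> R -> R) : \bar R :=
  (2^-1)%:E *
  'E_P[fun w => (psi (X w) ^+ 2 *
         (chi (X w) * k (X w) (Y w) + chi (Y w) * k' (X w) (Y w)))%R].

End expressions.

Arguments independent_RVs {d T R} P X Y.
Arguments has_df {d T R} P X F.
Arguments first_expr {d T R} P F X psi chi k.
Arguments middle_expr {d T R} P X Y psi chi k.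
Arguments last_expr {d T R} P X Y psi chi k k'.

(* Main.v *)
Require Import Defs.
From HB Require Import structures.
From mathcomp Require Import all_boot all_order all_algebra.
From mathcomp Require Import all_classical all_reals all_analysis.
From mathcomp Require Import measurable_realfun ring lra.

Set Implicit Arguments.
Unset Strict Implicit.

Import Order.TTheory GRing.Theory Num.Theory.
Import numFieldNormedType.Exports.

Local Open Scope classical_set_scope.
Local Open Scope ring_scope.
Local Open Scope ereal_scope.

(** Write [mu] for the common law of [X] and [Y], and [k] for the kernel
    [halflt] or [halfgt]; the other kernel is [k] with its arguments exchanged.
    By independence the law of [(X, Y)] is [mu \x mu], so Tonelli turns the
    middle expression into
      E(|psi(X)| chi(X) \int |psi(y) k(X, y)| dmu(y)),
    while the first one is
      E(|psi(X)| chi(X) |\int psi(y) k(X, y) dmu(y)|).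
    The first inequality is therefore the triangle inequality for integrals
    ([first_le_middle]). It is an equality when [psi] is a.e. constant, since
    then the inner integrand has constant sign ([first_eq_middle]).

    Since [(X, Y)] and [(Y, X)] have the same law, the second term of the last
    expression, E(psi(X)^2 chi(Y) k(Y, X)), equals
    E(psi(Y)^2 chi(X) k(X, Y)). Hence the last expression is the expectation of
    (psi(X)^2 + psi(Y)^2) / 2 * chi(X) k(X, Y) ([last_exprE]), and the second
    inequality is 2 |a b| <= a^2 + b^2 under the expectation, with equality when
    psi(X) = psi(Y) almost surely ([middle_le_last], [middle_eq_last]).

    Finally the two kernels add up to 1, and each of them vanishes where the
    other order relation holds strictly: if [chi] is monotone in the right
    direction, the bracket of the last expression is pointwise at most chi(X)
    ([last_le]).

    The function [psi] may fail to be integrable, so everything is computed in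
    the extended reals. Every integrand except [psi y * k x y] is nonnegative,
    and where the integral of that one takes the form oo - oo, the integral of
    its absolute value is +oo, so the triangle inequality still holds. *)

(** * Joint law of an independent pair with a given distribution function *)

Section law.
Context {d : measure_display} {T : measurableType d} {R : realType}.
Variables (P : probability T R) (F : cumulativeBounded (0 : R) (1 : R)).
Implicit Types X Y : {RV P >-> R}.

Lemma measurable_RV_ocitv X :
  measurable_fun [set: T] (X : T -> measurableTypeR R).
Proof. exact: (measurable_funP X). Qed.

(** Lebesgue-Stieltjes measures live on [measurableTypeR R], whose measurable
    sets are those of [R] but whose display is another one; this casts a random
    variable so that its law can be compared with such a measure. *)
Definition RV_ocitv X : {RV P >-> measurableTypeR R} :=
  HB.pack (X : T -> measurableTypeR R)
    (isMeasurableFun.Build _ _ _ _ _ (measurable_RV_ocitv X)).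

(** Both measures give F(b) - F(a) to the interval ]a, b], and a
    Lebesgue-Stieltjes measure is determined by these values. *)
Lemma lebesgue_stieltjes_law X (A : set (measurableTypeR R)) :
  has_df P X F -> measurable A ->
  lebesgue_stieltjes_measure F A = P (X @^-1` A).
Proof.
move=> XF mA.
rewrite (@lebesgue_stieltjes_measure_unique _ F (distribution P (RV_ocitv X))) //.
move=> I [[a b]] _ <- /=.
rewrite /lebesgue_stieltjes_measure /measure_extension /=.
rewrite measurable_mu_extE/=; last exact: is_ocitv.
have [ab|ba] := leP a b; last first.
  by rewrite set_itv_ge ?wlength0 ?measure0// bnd_simp -leNgt ltW.
rewrite wlength_itv_bnd// EFinB -!XF /cdf.
have -> : `]a, b]%classic = `]-oo, b] `\` `]-oo, a].
  by rewrite -[RHS]setCK setCD setCitvl setUC -[LHS]setCK setCitv.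
rewrite [RHS](@measureD _ _ _ (distribution P X)) ?setIidr//.
- exact: subset_itvl.
- by rewrite -ge0_fin_numE// fin_num_measure.
Qed.

Lemma independent_RVs_sym X Y : independent_RVs P X Y -> independent_RVs P Y X.
Proof. by move=> XY A B mA mB; rewrite setIC muleC XY. Qed.

Lemma measurable_RV_pair X Y : measurable_fun [set: T]
  (fun w => (RV_ocitv X w, RV_ocitv Y w)).
Proof. exact: measurable_fun_pair. Qed.

Definition RV_pair X Y :
    {RV P >-> (measurableTypeR R * measurableTypeR R)%type} :=
  HB.pack (fun w => (RV_ocitv X w, RV_ocitv Y w))
    (isMeasurableFun.Build _ _ _ _ _ (measurable_RV_pair X Y)).

(** Independence says that the law of the pair agrees with the product measure
    on rectangles, which characterizes the latter. *)
Lemma ge0_integral_iid X Y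
    (h : measurableTypeR R * measurableTypeR R -> \bar R) :
  independent_RVs P X Y -> has_df P X F -> has_df P Y F ->
  measurable_fun setT h -> (forall z, 0 <= h z) ->
  \int[P]_w h (X w, Y w) =
  \int[(lebesgue_stieltjes_measure F \x lebesgue_stieltjes_measure F)]_z h z.
Proof.
move=> XY XF YF mh h0.
rewrite -[LHS](@ge0_integral_distribution _ _ _ _ _ P (RV_pair X Y))//.
apply: eq_measure_integral => A mA _.
apply/esym/product_measure_unique => // B C mB mC.
transitivity (P (X @^-1` B) * P (Y @^-1` C)); first exact: XY.
by congr (_ * _); apply/esym; exact: lebesgue_stieltjes_law.
Qed.

(** The inner integral is the conditional expectation given [X], so this is the
    tower property for nonnegative functions of an independent pair. *)
Lemma ge0_integral_iid_fubini X Y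
    (h : measurableTypeR R * measurableTypeR R -> \bar R) :
  independent_RVs P X Y -> has_df P X F -> has_df P Y F ->
  measurable_fun setT h -> (forall z, 0 <= h z) ->
  \int[P]_w h (X w, Y w) =
  \int[P]_w \int[lebesgue_stieltjes_measure F]_y h (X w, y).
Proof.
move=> XY XF YF mh h0; rewrite ge0_integral_iid// fubini_tonelli1//.
have mG : measurable_fun setT (fubini_F (lebesgue_stieltjes_measure F) h).
  exact: measurable_fun_fubini_tonelli_F.
have G0 x : 0 <= fubini_F (lebesgue_stieltjes_measure F) h x.
  exact: integral_ge0.
rewrite -[RHS](@ge0_integral_distribution _ _ _ _ _ P (RV_ocitv X) _ mG G0).
apply: eq_measure_integral => A mA _.
exact: lebesgue_stieltjes_law.
Qed.

(** The product of a measure with itself does not see the order of the pair. *)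
Lemma ge0_integral_exchange X Y
    (h : measurableTypeR R * measurableTypeR R -> \bar R) :
  independent_RVs P X Y -> has_df P X F -> has_df P Y F ->
  measurable_fun setT h -> (forall z, 0 <= h z) ->
  \int[P]_w h (X w, Y w) = \int[P]_w h (Y w, X w).
Proof.
move=> XY XF YF mh h0; rewrite !ge0_integral_iid//.
exact: independent_RVs_sym.
Qed.

Lemma ae_RV X (Q : R -> Prop) : has_df P X F ->
  {ae lebesgue_stieltjes_measure F, forall x, Q x} ->
  {ae P, forall w, Q (X w)}.
Proof.
move=> XF [A [mA A0 QA]]; exists (X @^-1` A); split.
- exact: (measurable_funPTI (RV_ocitv X)).
- by rewrite -lebesgue_stieltjes_law.
- by move=> w; exact: QA.
Qed.

End law.

(** * Measurability *)

(** Tonelli's measurability statement concerns nonnegative functions; it is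
    applied to the positive and negative parts, whose difference of integrals
    is the integral of [f] by definition, integrable or not. *)
Lemma measurable_integral_section (d d' : measure_display)
    (T : measurableType d) (T' : measurableType d') (R : realType)
    (mu : {sigma_finite_measure set T' -> \bar R}) (f : T * T' -> \bar R) :
  measurable_fun setT f -> measurable_fun setT (fun x => \int[mu]_y f (x, y)).
Proof.
move=> mf; under eq_fun do rewrite integralE.
apply: emeasurable_funB.
- by have := @measurable_fun_fubini_tonelli_F _ _ _ _ _ mu _
    (measurable_funepos mf) (funepos_ge0 f); rewrite funepos.unlock.
- by have := @measurable_fun_fubini_tonelli_F _ _ _ _ _ mu _
    (measurable_funeneg mf) (funeneg_ge0 f); rewrite funeneg.unlock.
Qed.

Lemma measurable_flip (R : realType) (k : R -> R -> R) :
  measurable_fun [set: measurableTypeR R * measurableTypeR R]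
    (fun z => k z.1 z.2) ->
  measurable_fun [set: measurableTypeR R * measurableTypeR R]
    (fun z => k z.2 z.1).
Proof.
move=> mk; exact: (measurableT_comp mk
  (@measurable_swap _ _ (measurableTypeR R) (measurableTypeR R))).
Qed.

(** * The chain of inequalities for a nonnegative kernel *)

Section weighted_products.
Context {d : measure_display} {T : measurableType d} {R : realType}.
Variables (P : probability T R) (F : cumulativeBounded (0 : R) (1 : R)).
Variables (X Y : {RV P >-> R}) (psi chi : R -> R) (k k' : R -> R -> R).
Hypotheses (XY : independent_RVs P X Y) (XF : has_df P X F).
Hypotheses (YF : has_df P Y F).
Hypothesis mpsi : measurable_fun [set: R] psi.
Hypothesis mchi : measurable_fun [set: R] chi.
Hypothesis chi0 : forall x, (0 <= chi x)%R.
Hypothesis mk : measurable_fun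
  [set: measurableTypeR R * measurableTypeR R] (fun z => k z.1 z.2).
Hypothesis k0 : forall x y, (0 <= k x y)%R.
Hypothesis k'E : forall x y, k' x y = k y x.

Local Notation mu := (lebesgue_stieltjes_measure F).
Let RR := (measurableTypeR R * measurableTypeR R)%type.

Let mpsi1 : measurable_fun [set: RR] (fun z => psi z.1).
Proof. exact: (measurableT_comp (f := psi : measurableTypeR R -> R)). Qed.

Let mpsi2 : measurable_fun [set: RR] (fun z => psi z.2).
Proof. exact: (measurableT_comp (f := psi : measurableTypeR R -> R)). Qed.

Let mchi1 : measurable_fun [set: RR] (fun z => chi z.1).
Proof. exact: (measurableT_comp (f := chi : measurableTypeR R -> R)). Qed.

Let mchi2 : measurable_fun [set: RR] (fun z => chi z.2).
Proof. exact: (measurableT_comp (f := chi : measurableTypeR R -> R)). Qed.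

Let mkC : measurable_fun [set: RR] (fun z => k z.2 z.1).
Proof. exact: measurable_flip mk. Qed.

Let meas_XY (h : RR -> R) : measurable_fun setT h ->
  measurable_fun setT (fun w => h (X w, Y w)).
Proof. by move=> mh; exact: (measurableT_comp mh (measurable_RV_pair X Y)). Qed.

Lemma first_exprE : first_expr P F X psi chi k =
  \int[P]_w (`|\int[mu]_y (psi y * k (X w) y)%:E| *
             (`|psi (X w)| * chi (X w))%:E).
Proof.
by apply: eq_integral => w _; rewrite /cond_expectation abseM EFinM muleA.
Qed.

(** Conditioning on [X] gives the middle expression the shape of [first_exprE],
    with the absolute value inside the inner integral. *)
Lemma middle_exprE : middle_expr P X Y psi chi k =
  \int[P]_w ((\int[mu]_y `|(psi y * k (X w) y)%:E|) *
             (`|psi (X w)| * chi (X w))%:E).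
Proof.
rewrite /middle_expr unlock.
pose h (z : RR) := (`|psi z.1 * psi z.2| * chi z.1 * k z.1 z.2)%:E.
rewrite (@ge0_integral_iid_fubini _ _ _ P F X Y h)//.
- apply: eq_integral => w _; rewrite muleC -ge0_integralZl_EFin//.
  + apply: eq_integral => y _ /=; rewrite /h /= -EFinM !normrM.
    by rewrite (ger0_norm (k0 _ _)); congr EFin; ring.
  + apply/measurable_EFinP/measurableT_comp => //; apply: measurable_funM => //.
    exact: (measurable_fun_pair2 _ mk).
  + by rewrite mulr_ge0.
- apply/measurable_EFinP; apply: measurable_funM => //.
  apply: measurable_funM => //; apply: measurableT_comp => //.
  exact: measurable_funM.
- by move=> z; rewrite lee_fin !mulr_ge0.
Qed.

(** The triangle inequality for the inner integral, for each value of [X]. *)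
Lemma first_le_middle :
  first_expr P F X psi chi k <= middle_expr P X Y psi chi k.
Proof.
have mf : measurable_fun [set: RR] (fun z => (psi z.2 * k z.1 z.2)%:E).
  by apply/measurable_EFinP; exact: measurable_funM.
have mX : measurable_fun setT (fun w => (`|psi (X w)| * chi (X w))%:E).
  apply/measurable_EFinP; apply: measurable_funM; last exact: measurableT_comp.
  by apply: measurableT_comp => //; exact: measurableT_comp.
rewrite first_exprE middle_exprE; apply: ge0_le_integral => //.
- by move=> w _; rewrite mule_ge0// lee_fin mulr_ge0.
- apply: emeasurable_funM => //; apply: measurableT_comp => //.
  apply: (measurableT_comp (measurable_integral_section mu mf)).
  exact: (measurable_RV_ocitv X).
- apply: emeasurable_funM => //.
  have maf := measurableT_comp (@abse_measurable R setT) mf.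
  apply: (measurableT_comp (measurable_integral_section mu maf)).
  exact: (measurable_RV_ocitv X).
- move=> w _; apply: lee_wpmul2r; first by rewrite lee_fin mulr_ge0.
  apply: le_abse_integral => //.
  exact: (measurable_fun_pair2 _ mf).
Qed.

(** For each value of [X] the inner integrand is a.e. [c * k (X w) y], which
    keeps the sign of [c], so taking absolute values before or after integrating
    is the same. *)
Lemma first_eq_middle c : {ae mu, forall x, psi x = c} ->
  first_expr P F X psi chi k = middle_expr P X Y psi chi k.
Proof.
move=> psic; rewrite first_exprE middle_exprE.
apply: eq_integral => w _; congr (_ * _).
have mf : measurable_fun [set: measurableTypeR R]
    (fun y => (psi y * k (X w) y)%:E).
  apply/measurable_EFinP; apply: measurable_funM => //.
  exact: (measurable_fun_pair2 _ mk).
have mg a : measurable_fun [set: measurableTypeR R]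
    (fun y => (a * k (X w) y)%:E).
  apply/measurable_EFinP; apply: measurable_funM => //.
  exact: (measurable_fun_pair2 _ mk).
have fg : \int[mu]_y (psi y * k (X w) y)%:E = \int[mu]_y (c * k (X w) y)%:E.
  apply: ae_eq_integral => //.
  by apply: negligibleS psic => y /=; apply: contra_not => -> _.
have afg : \int[mu]_y `|(psi y * k (X w) y)%:E| =
    \int[mu]_y (`|c| * k (X w) y)%:E.
  apply: ae_eq_integral => //; first exact: measurableT_comp.
  apply: negligibleS psic => y /=; apply: contra_not => -> _.
  by rewrite normrM (ger0_norm (k0 _ _)).
rewrite fg afg; have [c0|c0] := leP 0%R c.
  rewrite (ger0_norm c0) gee0_abs// integral_ge0// => y _.
  by rewrite lee_fin mulr_ge0.
have ck0 y : 0 <= (`|c| * k (X w) y)%:E by rewrite lee_fin mulr_ge0.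
rewrite (eq_integral
  (fun y : measurableTypeR R => - (`|c| * k (X w) y)%:E)); last first.
  by move=> y _; rewrite (ltr0_norm c0) mulNr EFinN oppeK.
by rewrite integral_ge0N// abseN gee0_abs// integral_ge0.
Qed.

(** Exchanging [X] and [Y] in the term that carries [chi (Y w)] brings both
    terms over the same weight [chi (X w) * k (X w) (Y w)]. *)
Lemma last_exprE : last_expr P X Y psi chi k k' =
  'E_P[fun w => (2^-1 * (psi (X w) ^+ 2 + psi (Y w) ^+ 2) *
                 (chi (X w) * k (X w) (Y w)))%R].
Proof.
have mA : measurable_fun [set: RR]
    (fun z => psi z.1 ^+ 2 * (chi z.1 * k z.1 z.2))%R.
  by apply: measurable_funM; [exact: measurable_funX|exact: measurable_funM].
have mB : measurable_fun [set: RR]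
    (fun z => psi z.1 ^+ 2 * (chi z.2 * k z.2 z.1))%R.
  by apply: measurable_funM; [exact: measurable_funX|exact: measurable_funM].
have mB' : measurable_fun [set: RR]
    (fun z => psi z.2 ^+ 2 * (chi z.1 * k z.1 z.2))%R.
  by apply: measurable_funM; [exact: measurable_funX|exact: measurable_funM].
have h0 a x y z : (0 <= a ^+ 2 * (chi x * k y z))%R.
  by rewrite mulr_ge0 ?sqr_ge0// mulr_ge0.
rewrite /last_expr unlock.
transitivity (2^-1%:E * (\int[P]_w (
    (psi (X w) ^+ 2 * (chi (X w) * k (X w) (Y w)))%:E +
    (psi (X w) ^+ 2 * (chi (Y w) * k (Y w) (X w)))%:E))).
  by congr (_ * _); apply: eq_integral => w _; rewrite k'E -EFinD -mulrDr.
rewrite ge0_integralD//; last 4 first.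
- by move=> w _; rewrite lee_fin.
- by apply/measurable_EFinP; exact: meas_XY mA.
- by move=> w _; rewrite lee_fin.
- by apply/measurable_EFinP; exact: meas_XY mB.
rewrite (@ge0_integral_exchange _ _ _ P F X Y
  (fun z : RR => (psi z.1 ^+ 2 * (chi z.2 * k z.2 z.1))%:E))//; last 2 first.
- exact/measurable_EFinP.
- by move=> z; rewrite lee_fin.
rewrite -ge0_integralD//; last 4 first.
- by move=> w _; rewrite lee_fin.
- by apply/measurable_EFinP; exact: meas_XY mA.
- by move=> w _; rewrite lee_fin.
- by apply/measurable_EFinP; exact: meas_XY mB'.
rewrite -ge0_integralZl_EFin//.
- by apply: eq_integral => w _; rewrite /= -EFinD -EFinM; congr EFin; ring.
- by move=> w _; rewrite adde_ge0// lee_fin.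
- apply: emeasurable_funD; apply/measurable_EFinP.
  + exact: meas_XY mA.
  + exact: meas_XY mB'.
Qed.

Let mmiddle : measurable_fun [set: T]
  (fun w => (`|psi (X w) * psi (Y w)| * chi (X w) * k (X w) (Y w))%:E).
Proof.
apply/measurable_EFinP.
apply: (meas_XY (h := fun z : RR =>
  `|psi z.1 * psi z.2| * chi z.1 * k z.1 z.2)%R).
apply: measurable_funM => //.
apply: measurable_funM => //; apply: measurableT_comp => //.
exact: measurable_funM.
Qed.

Let mlast : measurable_fun [set: T] (fun w =>
  (2^-1 * (psi (X w) ^+ 2 + psi (Y w) ^+ 2) * (chi (X w) * k (X w) (Y w)))%:E).
Proof.
apply/measurable_EFinP.
apply: (meas_XY (h := fun z : RR =>
  2^-1 * (psi z.1 ^+ 2 + psi z.2 ^+ 2) * (chi z.1 * k z.1 z.2))%R).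
apply: measurable_funM; last exact: measurable_funM.
by apply: measurable_funM => //; apply: measurable_funD; exact: measurable_funX.
Qed.

(** Pointwise 2 |psi(X) psi(Y)| <= psi(X)^2 + psi(Y)^2 under the common
    weight. *)
Lemma middle_le_last :
  middle_expr P X Y psi chi k <= last_expr P X Y psi chi k k'.
Proof.
rewrite last_exprE /middle_expr unlock; apply: ge0_le_integral => //.
- by move=> w _; rewrite lee_fin !mulr_ge0.
- move=> w _; rewrite lee_fin -mulrA ler_wpM2r ?mulr_ge0//.
  rewrite normrM -(real_normK (num_real (psi (X w)))).
  rewrite -(real_normK (num_real (psi (Y w)))).
  have := sqr_ge0 (`|psi (X w)| - `|psi (Y w)|)%R.
  rewrite sqrrB; lra.
Qed.

Lemma middle_eq_last c : {ae mu, forall x, psi x = c} ->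
  middle_expr P X Y psi chi k = last_expr P X Y psi chi k k'.
Proof.
move=> psic; rewrite last_exprE /middle_expr unlock; apply: ae_eq_integral => //.
have := ae_RV XF psic; have := ae_RV YF psic.
apply: filterS2 => w /= -> -> _.
by rewrite -expr2 ger0_norm ?sqr_ge0//; congr EFin; field.
Qed.

Lemma last_le :
  (forall x y, chi x * k x y + chi y * k' x y <= chi x)%R ->
  last_expr P X Y psi chi k k' <=
  (2^-1)%:E * 'E_P[fun w => (psi (X w) ^+ 2 * chi (X w))%R].
Proof.
move=> kchi; rewrite /last_expr unlock lee_pmul2l// ?lte_fin ?invr_gt0//.
apply: ge0_le_integral => //.
- by move=> w _; rewrite lee_fin k'E mulr_ge0 ?sqr_ge0// addr_ge0 ?mulr_ge0.
- apply/measurable_EFinP.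
  under eq_fun do rewrite k'E.
  apply: (meas_XY (h := fun z : RR =>
    psi z.1 ^+ 2 * (chi z.1 * k z.1 z.2 + chi z.2 * k z.2 z.1)))%R.
  apply: measurable_funM; first exact: measurable_funX.
  by apply: measurable_funD; exact: measurable_funM.
- apply/measurable_EFinP.
  apply: (meas_XY (h := fun z : RR => psi z.1 ^+ 2 * chi z.1))%R.
  by apply: measurable_funM => //; exact: measurable_funX.
- by move=> w _; rewrite lee_fin ler_wpM2l ?sqr_ge0.
Qed.

End weighted_products.

(** * The two half-weighted indicators *)

Section half_indicators.
Context {R : realType}.

Lemma halfgtE (x y : R) : halfgt x y = halflt y x.
Proof. by rewrite /halflt /halfgt eq_sym. Qed.

Lemma halflt_ge0 (x y : R) : (0 <= halflt x y)%R.
Proof. by rewrite addr_ge0// mulr_ge0// invr_ge0. Qed.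

Lemma halfgt_ge0 (x y : R) : (0 <= halfgt x y)%R.
Proof. by rewrite halfgtE halflt_ge0. Qed.

(** The two indicators share the diagonal equally, which makes them a partition
    of unity even when the law has atoms. *)
Lemma halfltDgt (x y : R) : (halflt x y + halfgt x y = 1)%R.
Proof.
by rewrite /halflt /halfgt; case: ltgtP => _ /=; rewrite ?mulr0 ?mulr1; lra.
Qed.

Lemma halfgt_eq0 (x y : R) : (y < x)%R -> halfgt x y = 0%R.
Proof.
by move=> yx; rewrite /halfgt ltNge (ltW yx) (lt_eqF yx) mulr0 addr0.
Qed.

Lemma measurable_halflt : measurable_fun
  [set: measurableTypeR R * measurableTypeR R] (fun z => halflt z.1 z.2).
Proof.
have mfst : measurable_fun [set: measurableTypeR R * measurableTypeR R]
    (fun z => z.1 : R) by exact: measurable_fst.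
have msnd : measurable_fun [set: measurableTypeR R * measurableTypeR R]
    (fun z => z.2 : R) by exact: measurable_snd.
have mnat (b : measurableTypeR R * measurableTypeR R -> bool) :
    measurable_fun setT b -> measurable_fun setT (fun z => (b z)%:R : R).
  exact: (measurableT_comp (f := fun b : bool => b%:R : R)).
apply: measurable_funD; first by apply: mnat; exact: measurable_fun_ltr.
by apply: measurable_funM => //; apply: mnat; exact: measurable_fun_eqr.
Qed.

Lemma measurable_halfgt : measurable_fun
  [set: measurableTypeR R * measurableTypeR R] (fun z => halfgt z.1 z.2).
Proof.
under eq_fun do rewrite halfgtE.
exact: measurable_flip measurable_halflt.
Qed.

End half_indicators.

(** * The inequalities for both indicators *)

Theorem theorem5p1 (R : realType) (d : measure_display) (T : measurableType d)
    (P : probability T R) (X Y : {RV P >-> R})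
    (F : cumulativeBounded (0 : R) (1 : R)) (psi chi : R -> R)
    (XYindep : independent_RVs P X Y) (XF : has_df P X F) (YF : has_df P Y F)
    (mpsi : measurable_fun [set: R] psi)
    (mchi : measurable_fun [set: R] chi)
    (chi_ge0 : forall x : R, (0 <= chi x)%R) :
  [/\ first_expr P F X psi chi halflt <= middle_expr P X Y psi chi halflt
        <= last_expr P X Y psi chi halflt halfgt,
      first_expr P F X psi chi halfgt <= middle_expr P X Y psi chi halfgt
        <= last_expr P X Y psi chi halfgt halflt,
      ((exists c : R, {ae lebesgue_stieltjes_measure F, forall x, psi x = c}) ->
       [/\ first_expr P F X psi chi halflt = middle_expr P X Y psi chi halflt,
           middle_expr P X Y psi chi halflt
           = last_expr P X Y psi chi halflt halfgt,
           first_expr P F X psi chi halfgt = middle_expr P X Y psi chi halfgt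
         & middle_expr P X Y psi chi halfgt
           = last_expr P X Y psi chi halfgt halflt]),
      (nonincreasing_fun chi ->
       last_expr P X Y psi chi halflt halfgt
       <= (2^-1)%:E * 'E_P[fun w => (psi (X w) ^+ 2 * chi (X w))%R])
    & (nondecreasing_fun chi ->
       last_expr P X Y psi chi halfgt halflt
       <= (2^-1)%:E * 'E_P[fun w => (psi (X w) ^+ 2 * chi (X w))%R])].
Proof.
have mlt := @measurable_halflt R; have mgt := @measurable_halfgt R.
have lt0 := @halflt_ge0 R; have gt0 := @halfgt_ge0 R.
have gtC := @halfgtE R.
have ltC (x y : R) : halflt x y = halfgt y x by rewrite gtC.
split.
- apply/andP; split; first exact: first_le_middle.
  exact: (middle_le_last XYindep XF YF).
- apply/andP; split; first exact: first_le_middle.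
  exact: (middle_le_last XYindep XF YF).
- move=> [c psic]; split.
  + exact: (first_eq_middle XYindep XF YF _ _ _ _ _ psic).
  + exact: (middle_eq_last XYindep XF YF _ _ _ _ _ _ psic).
  + exact: (first_eq_middle XYindep XF YF _ _ _ _ _ psic).
  + exact: (middle_eq_last XYindep XF YF _ _ _ _ _ _ psic).
- move=> chi_dec; apply: last_le => // x y.
  (* With 1 = halflt x y + halfgt x y, what remains is to compare chi y with
     chi x under the weight halfgt x y, which vanishes unless x <= y. *)
  rewrite -[leRHS]mulr1 -(halfltDgt x y) [leRHS]mulrDr lerD2l.
  have [xy|/halfgt_eq0->] := leP x y; last by rewrite !mulr0.
  by rewrite ler_wpM2r// chi_dec.
- move=> chi_inc; apply: last_le => // x y.
  rewrite -[leRHS]mulr1 -(halfltDgt x y) [leRHS]mulrDr [leRHS]addrC lerD2l.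
  have [yx|] := leP y x; first by rewrite ler_wpM2r// chi_inc.
  by rewrite ltC => /halfgt_eq0->; rewrite !mulr0.
Qed.
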